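(* Let $B$ be a binary tree with at least two leaves. Then for every integer $d\ge 2$, $$i_d(B)=i_2(B)=I_d(B)=I_2(B).$$
   Context: All trees are finite and rooted, with unordered children; isomorphism means isomorphism of rooted trees. The single vertex is regarded as a tree whose only vertex is both root and leaf. For a rooted tree $T$, $|T|$ denotes its number of leaves. For an integer $d\ge 2$, a $d$-ary tree is a rooted tree in which every non-leaf vertex has between $2$ and $d$ children; it is strictly $d$-ary if every non-leaf vertex has exactly $d$ children. (An $n$-leaf strictly $d$-ary tree exists iff $n\ge 1$ and $n\equiv 1 \bmod (d-1)$.) A binary tree is a $2$-ary tree. For a nonempty set $S$ of leaves of $T$, the subtree of $T$ induced by $S$ is obtained by taking the minimal subtree of $T$ containing the leaves in $S$, rooting it at the most recent common ancestor of $S$, and suppressing (contracting) all non-root vertices of degree $2$. Let $c(D,T)$ be the number of sets of $|D|$ leaves of $T$ whose induced subtree is isomorphic to $D$, and for $|T|\ge |D|$ let $\gamma(D,T)=c(D,T)/\binom{|T|}{|D|}$. For a $d$-ary tree $D$ define $$I_d(D)=\limsup_{n\to\infty}\ \max_{|T|=n,\ T\ d\text{-ary}}\gamma(D,T),\qquad i_d(D)=\limsup_{n\to\infty}\ \max_{|T|=n,\ T\text{ strictly }d\text{-ary}}\gamma(D,T),$$ where in the second definition $n$ ranges over integers $n\equiv 1 \bmod (d-1)$. *)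

(* Defs.v *)
From HB Require Import structures.
From mathcomp Require Import all_boot all_order all_algebra.
From mathcomp Require Import all_classical all_reals all_analysis.

Set Implicit Arguments.
Unset Strict Implicit.
Unset Printing Implicit Defensive.

Import Order.TTheory GRing.Theory Num.Theory.

(* A finite rooted tree, given by the list of its root branches; a leaf is
   [Node [::]].  The order of the branches is an artefact of the encoding: trees
   are only ever compared up to [isomorphic] below, which ignores it. *)
Inductive rtree : Type := Node of seq rtree.

(* Vertices are named by their address: the list of branch indices followed from
   the root, whose own address is [[::]]. *)
Definition address := seq nat.

Definition parent (v : address) : address := take (size v).-1 v.

Section IndexedMap.
Variables (A B : Type) (f : nat -> A -> B).

(* [:: f i x0; f i.+1 x1; ...] *)
Fixpoint imap (i : nat) (s : seq A) : seq B :=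
  if s is x :: s' then f i x :: imap i.+1 s' else [::].
End IndexedMap.

Fixpoint vertices (T : rtree) : seq address :=
  let: Node ts := T in
  [::] :: flatten (imap (fun i t => map (cons i) (vertices t)) 0 ts).

Fixpoint leaves (T : rtree) : seq address :=
  let: Node ts := T in
  if ts is [::] then [:: [::]]
  else flatten (imap (fun i t => map (cons i) (leaves t)) 0 ts).

Definition nleaves (T : rtree) : nat := size (leaves T).

(* An isomorphism is a bijection between the vertex sets (both lists of addresses
   are duplicate-free) which preserves the root and the parent relation. *)
Definition isomorphic (T U : rtree) : Prop :=
  exists f : address -> address,
    [/\ perm_eq (map f (vertices T)) (vertices U),
        f [::] = [::] &
        {in vertices T, forall v, v != [::] -> f (parent v) = parent (f v)}].

Fixpoint nonleaf_degrees (P : pred nat) (T : rtree) : bool :=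
  let: Node ts := T in
  (nilp ts || P (size ts)) && all (nonleaf_degrees P) ts.

Definition dary (d : nat) : rtree -> bool :=
  nonleaf_degrees (fun k => 2 <= k <= d).

Definition strictly_dary (d : nat) : rtree -> bool :=
  nonleaf_degrees (fun k => k == d).

Definition binary : rtree -> bool := dary 2.

(* The union of the paths from the root of T to the leaves in S; [None] if S
   contains no leaf of T. *)
Fixpoint prune (T : rtree) (S : pred address) : option rtree :=
  let: Node ts := T in
  if ts is [::] then (if S [::] then Some (Node [::]) else None)
  else let us := pmap id (imap (fun i t => prune t (fun v => S (i :: v))) 0 ts) in
       if us is [::] then None else Some (Node us).

(* Moves the root down to the first vertex that does not have exactly one child.
   After [prune] this is the most recent common ancestor of the leaves, so the
   result is the minimal subtree containing them, rooted there. *)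
Fixpoint reroot (T : rtree) : rtree :=
  if T is Node [:: t] then reroot t else T.

(* Contracts the vertices with exactly one child.  After [reroot] the root is not
   one of them, so these are exactly the non-root vertices of degree 2. *)
Fixpoint suppress (T : rtree) : rtree :=
  match T with
  | Node [:: t] => suppress t
  | Node ts => Node (map suppress ts)
  end.

Definition induced (T : rtree) (S : {set seq_sub (leaves T)}) : option rtree :=
  omap (suppress \o reroot) (prune T (fun v => v \in [seq val x | x in S])).

Definition copies (D T : rtree) : nat :=
  #|[set S : {set seq_sub (leaves T)} | (#|S| == nleaves D) &&
      `[< exists2 U, induced S = Some U & isomorphic U D >]]|.

Section Inducibility.
Local Open Scope classical_set_scope.
Local Open Scope ring_scope.

Definition density (R : realType) (D T : rtree) : R :=
  (copies D T)%:R / 'C(nleaves T, nleaves D)%:R.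

(* The supremum is a maximum whenever some tree with n leaves satisfies P, since
   only finitely many values occur for given n; otherwise it is -oo. *)
Definition max_density (R : realType) (P : pred rtree) (D : rtree) (n : nat)
    : \bar R :=
  ereal_sup [set (density R D T)%:E | T in [set T | nleaves T = n /\ P T]].

Definition inducibility (R : realType) (d : nat) (D : rtree) : \bar R :=
  limn_esup (max_density R (dary d) D).

(* The limit superior along the integers n congruent to 1 modulo d - 1. *)
Definition strict_inducibility (R : realType) (d : nat) (D : rtree) : \bar R :=
  limf_esup (max_density R (strictly_dary d) D)
    (within [set n | n = 1 %[mod d.-1]] \oo).

End Inducibility.

(* Main.v *)
(* Splitting every vertex with more than two children into a caterpillar turns
   a d-ary tree into a binary one with the same leaves, and a leaf set inducing
   a binary tree still induces the same tree: I_d(B) <= I_2(B).  Conversely,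
   graft a complete d-ary tree with M leaves on every leaf of a binary tree with
   n leaves, and pad every other internal vertex with d - 2 leaves.  The result
   is strictly d-ary, has at most (M + d) n leaves and at least M^|B| times as
   many copies of B, so its density is at least the original one up to a factor
   that tends to 1 when M and then n go to infinity: I_2(B) <= i_d(B).

   Copies are counted through ordered trees: [skeletons T] lists the ordered
   trees induced by all leaf sets, and for a binary ordered tree the
   multiplicity in [skeletons (Node ts)] is a polynomial in the
   multiplicities in the branches. *)
Require Import Defs.
From HB Require Import structures.
From mathcomp Require Import all_boot all_order all_algebra.
From mathcomp Require Import all_classical all_reals all_analysis.
From mathcomp Require Import zify ring lra.

Set Implicit Arguments.
Unset Strict Implicit.
Unset Printing Implicit Defensive.

Import Order.TTheory GRing.Theory Num.Theory.

(** * Tree induction and leaf addresses *)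

HB.instance Definition _ := gen_eqMixin rtree.

(** The branches sit inside a list, so the induction hypothesis on them comes from a fixpoint nested
    with an induction on that list. *)
Lemma rtree_ind_mem (P : rtree -> Prop) :
  (forall ts, {in ts, forall t, P t} -> P (Node ts)) -> forall T, P T.
Proof.
move=> IH; fix rec 1; case=> ts; apply: IH.
elim: ts => [|t ts IHts] u; first by clear rec; rewrite in_nil.
rewrite in_cons => /orP[/eqP->|]; first exact: rec.
exact: IHts.
Qed.

Section Imap.
Variables (A B C : Type).

Lemma map_imap (g : B -> C) (f : nat -> A -> B) i s :
  map g (imap f i s) = imap (fun j x => g (f j x)) i s.
Proof. by elim: s i => //= x s IH i; rewrite IH. Qed.

Lemma imap_const (f : A -> B) i s : imap (fun=> f) i s = map f s.
Proof. by elim: s i => //= x s IH i; rewrite IH. Qed.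

Lemma eq_imap (f g : nat -> A -> B) i s :
  (forall j x, i <= j -> f j x = g j x) -> imap f i s = imap g i s.
Proof.
elim: s i => //= x s IH i fg; rewrite fg// IH// => j y ij.
by apply: fg; exact: ltnW.
Qed.

End Imap.

Lemma leaves_node ts : ts != [::] ->
  leaves (Node ts) = flatten (imap (fun i t => map (cons i) (leaves t)) 0 ts).
Proof. by case: ts. Qed.

Lemma nleaves_node ts : ts != [::] -> nleaves (Node ts) = sumn (map nleaves ts).
Proof.
move=> ts0; rewrite /nleaves leaves_node// -[in RHS](imap_const _ 0).
rewrite size_flatten /shape map_imap.
by congr sumn; apply: eq_imap => j x _; rewrite size_map.
Qed.

Lemma nleaves_gt0 T : 0 < nleaves T.
Proof.
elim/rtree_ind_mem: T => -[|t ts] IH //.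
by rewrite nleaves_node//= addn_gt0 IH ?mem_head.
Qed.

Lemma mem_flatten_imap (A : eqType) (f : A -> seq address) i (s : seq A) v :
  v \in flatten (imap (fun j x => map (cons j) (f x)) i s) ->
  exists2 j, i <= j & exists w, v = j :: w.
Proof.
elim: s i => //= x s IH i; rewrite mem_cat => /orP[/mapP[w _ ->]|/IH[j ij [w ->]]].
  by exists i => //; exists w.
by exists j; [exact: ltnW | exists w].
Qed.

Lemma uniq_leaves T : uniq (leaves T).
Proof.
elim/rtree_ind_mem: T => -[|t ts] IH //.
rewrite leaves_node//.
elim: (t :: ts) 0 IH => //= u us IHus i IH.
rewrite cat_uniq map_inj_uniq ?IH ?mem_head//=; last by move=> x y [].
rewrite IHus ?andbT; last by move=> x xus; apply: IH; rewrite in_cons xus orbT.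
apply/hasPn => v /mem_flatten_imap[j ij [w ->]].
by apply/mapP => -[w' _ [jE _]]; rewrite jE ltnn in ij.
Qed.

(** * Induced trees by recursion on the branches *)

Definition join (us : seq rtree) : option rtree :=
  match us with
  | [::] => None
  | [:: u] => Some u
  | _ => Some (Node us)
  end.

(** [reroot] is left out: [suppress] also contracts a unary root, so the resulting tree is the same,
    and the recursion over branches becomes uniform. *)
Definition skeleton (T : rtree) (S : pred address) : option rtree :=
  omap suppress (prune T S).

Lemma suppress_reroot T : suppress (reroot T) = suppress T.
Proof.
elim/rtree_ind_mem: T => -[|t [|u ts]] IH //=.
by rewrite IH ?mem_head.
Qed.

Lemma prune_node ts S : ts != [::] ->
  prune (Node ts) S =
  let us := pmap id (imap (fun i t => prune t (fun v => S (i :: v))) 0 ts) in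
  if us is [::] then None else Some (Node us).
Proof. by case: ts. Qed.

Lemma skeleton_node ts S : ts != [::] ->
  skeleton (Node ts) S =
  join (pmap id (imap (fun i t => skeleton t (fun v => S (i :: v))) 0 ts)).
Proof.
move=> ts0; rewrite /skeleton -map_imap.
have -> (s : seq (option rtree)) :
    pmap id (map (omap suppress) s) = map suppress (pmap id s).
  by elim: s => // -[u|] s IH //=; rewrite IH.
rewrite prune_node//.
by case: (pmap _ _) => [|u [|v us]].
Qed.

Lemma suppress_nonleaf_degrees T : nonleaf_degrees (leq 2) (suppress T).
Proof.
elim/rtree_ind_mem: T => -[|t [|u ts]] IH //=.
  by rewrite IH// mem_head.
rewrite !IH ?in_cons ?eqxx ?orbT//= all_map.
by apply/allP => x xts; apply: IH; rewrite !in_cons xts !orbT.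
Qed.

Definition onleaves (o : option rtree) : nat := oapp nleaves 0 o.

Lemma onleaves_join us : onleaves (join us) = sumn (map nleaves us).
Proof.
by case: us => [|u [|v us]] //=; rewrite ?addn0// nleaves_node.
Qed.

(** Contraction loses no chosen leaf; this lets the size of a leaf set be read off the tree it
    induces. *)
Lemma onleaves_skeleton T S : onleaves (skeleton T S) = count S (leaves T).
Proof.
elim/rtree_ind_mem: T S => -[|t ts] IH S.
  by rewrite /skeleton /=; case: (S [::]).
rewrite skeleton_node// onleaves_join leaves_node//.
elim: (t :: ts) 0 IH => //= u us IHus i IH.
rewrite count_cat count_map -IHus; last first.
  by move=> x xus; apply: IH; rewrite in_cons xus orbT.
have := IH u (mem_head _ _) (fun v => S (i :: v)).
by rewrite /preim; case: (skeleton u _) => /= [v|] <-.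
Qed.

(** * Leaf sets as sublists *)

Section Sublists.
Variable A : Type.
Implicit Type s : seq A.

Fixpoint sublists s : seq (seq A) :=
  if s is x :: s' then map (cons x) (sublists s') ++ sublists s' else [:: [::]].

Lemma size_sublists s : size (sublists s) = 2 ^ size s.
Proof. by elim: s => //= x s IH; rewrite size_cat size_map IH expnS mul2n addnn. Qed.

Lemma sublists_cat s1 s2 :
  sublists (s1 ++ s2) = [seq a ++ b | a <- sublists s1, b <- sublists s2].
Proof.
elim: s1 => /= [|x s1 IH]; first by rewrite cats0 map_id.
by rewrite allpairs_cat IH map_allpairs allpairs_mapl.
Qed.

End Sublists.

Lemma sublists_map (A B : Type) (f : A -> B) s :
  sublists (map f s) = map (map f) (sublists s).
Proof. by elim: s => //= x s IH; rewrite map_cat IH -!map_comp. Qed.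

Lemma mem_filter_sublists (A : eqType) (p : pred A) (s : seq A) :
  [seq x <- s | p x] \in sublists s.
Proof.
elim: s => /= [|x s IH]; first by rewrite mem_seq1.
by case: ifP => _; rewrite mem_cat ?IH ?orbT// map_f.
Qed.

Lemma sublists_sub (A : eqType) (s a : seq A) :
  a \in sublists s -> {subset a <= s}.
Proof.
elim: s a => /= [|x s IH] a; first by rewrite mem_seq1 => /eqP->.
rewrite mem_cat => /orP[/mapP[b /IH bs ->]|/IH as_] y.
  by rewrite !in_cons => /orP[->|/bs->]//; rewrite orbT.
by move=> /as_; rewrite in_cons => ->; rewrite orbT.
Qed.

(** Sending a sublist to its set of entries hits every subset of [L]; both sides have 2 ^ [size L]
    elements, so it is a bijection. *)
Lemma card_sublists (A : choiceType) (L : seq A) (P : pred {set seq_sub L}) :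
  uniq L ->
  #|[set S | P S]| = count (fun s => P [set x | val x \in s]) (sublists L).
Proof.
move=> uL; pose g (s : seq A) : {set seq_sub L} := [set x | val x \in s].
rewrite cardsE cardE /enum_mem size_filter -/(enum_mem _).
rewrite -(count_map g P).
suff /permP-> : perm_eq (Finite.enum {set seq_sub L}) (map g (sublists L)).
  by apply: eq_count.
have gP S : S \in map g (sublists L).
  apply/mapP; exists [seq x <- L | x \in [seq val y | y in S]].
    exact: mem_filter_sublists.
  apply/setP => x; rewrite inE mem_filter (valP x) andbT.
  by rewrite fintype.mem_image//; exact: val_inj.
have uE : uniq (Finite.enum {set seq_sub L}) by rewrite -enumT enum_uniq.
have sz : size (map g (sublists L)) = size (Finite.enum {set seq_sub L}).
  rewrite size_map size_sublists -enumT -cardT -cardsT -powersetT.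
  by rewrite card_powerset cardsT card_seq_sub.
have sub : {subset Finite.enum {set seq_sub L} <= map g (sublists L)}.
  by move=> S _; exact: gP.
apply: uniq_perm => //; first by apply: leq_size_uniq uE sub _; rewrite sz.
by case: (uniq_min_size uE sub); rewrite // sz.
Qed.

(** * The list of all induced trees *)

Definition forests (ls : seq (seq (option rtree))) : seq (seq rtree) :=
  foldr (fun l F => [seq oapp (cons^~ us) us o | o <- l, us <- F]) [:: [::]] ls.

Fixpoint skeletons (T : rtree) : seq (option rtree) :=
  let: Node ts := T in
  if ts is [::] then [:: Some (Node [::]); None]
  else map join (forests (map skeletons ts)).

Lemma skeletons_node ts : ts != [::] ->
  skeletons (Node ts) = map join (forests (map skeletons ts)).
Proof. by case: ts. Qed.

(** A leaf set of a node is an independent choice of a leaf set in each branch; [forests] makes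
    these choices and drops the branches left empty. *)
Lemma skeletonsE T :
  skeletons T = [seq skeleton T (mem s) | s <- sublists (leaves T)].
Proof.
elim/rtree_ind_mem: T => -[|t ts] IH //.
rewrite skeletons_node// leaves_node//.
under [RHS]eq_map => s do rewrite skeleton_node//.
rewrite [RHS](map_comp join
  (fun s => pmap id
    (imap (fun i t => skeleton t (fun v => i :: v \in s)) 0 (t :: ts)))).
congr map; elim: (t :: ts) 0 IH => //= u us IHus i IH.
rewrite sublists_cat map_allpairs sublists_map allpairs_mapl.
rewrite (IHus i.+1); last by move=> x xus; apply: IH; rewrite in_cons xus orbT.
rewrite (IH u (mem_head _ _)) allpairs_mapl allpairs_mapr.
apply/eq_in_allpairs => a b _ bs /=.
(* Addresses in [b] start with an index above [i], so branch [i] sees only [a] and the later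
   branches see only [b]. *)
have -> : skeleton u (fun v => i :: v \in map (cons i) a ++ b) =
    skeleton u (mem a).
  congr skeleton; apply/funext => v; rewrite mem_cat mem_map; last by move=> x y [].
  rewrite [X in _ || X](_ : _ = false) ?orbF//; apply/negP => /(sublists_sub bs).
  by move=> /mem_flatten_imap[j ij [w [ijE _]]]; rewrite ijE ltnn in ij.
have -> :
    imap (fun j t => skeleton t (fun v => j :: v \in map (cons i) a ++ b)) i.+1 us =
     imap (fun j t => skeleton t (fun v => j :: v \in b)) i.+1 us.
  apply: eq_imap => j x ij; congr skeleton; apply/funext => v.
  rewrite mem_cat [X in X || _](_ : _ = false)//; apply/mapP => -[w _ [ijE _]].
  by rewrite ijE ltnn in ij.
by case: skeleton.
Qed.

(** * Recognizing binary trees by their number of vertices *)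

Lemma size_vertices_node ts :
  size (vertices (Node ts)) = (sumn (map (size \o vertices) ts)).+1.
Proof.
rewrite [vertices _]/= [size _]/= size_flatten /shape map_imap.
rewrite -[in RHS](imap_const _ 0); congr (sumn _).+1.
by apply: eq_imap => j x _; rewrite size_map.
Qed.

(** If m branches have at most 2 l_i - 1 vertices each, a tree with l leaves has at most 2 l - m + 1
    of them. As m >= 2 this is at most 2 l - 1, with equality only if m = 2 and every branch is
    extremal. *)
Lemma size_vertices_leq T : nonleaf_degrees (leq 2) T ->
  size (vertices T) < (nleaves T).*2 /\
  ((size (vertices T)).+1 = (nleaves T).*2 -> binary T).
Proof.
elim/rtree_ind_mem: T => -[|t ts] IH // /andP[deg2 degs].
rewrite size_vertices_node nleaves_node//.
set us := t :: ts in IH degs deg2 *.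
have [le_us eq_us] :
    sumn (map (size \o vertices) us) + size us <= (sumn (map nleaves us)).*2 /\
    (sumn (map (size \o vertices) us) + size us = (sumn (map nleaves us)).*2 ->
      all binary us).
  elim: (us) IH degs => //= u vs IHvs IH /andP[degu degvs].
  have [leu equ] := IH u (mem_head _ _) degu.
  have [|levs eqvs] := IHvs _ degvs.
    by move=> x xvs; apply: IH; rewrite in_cons xvs orbT.
  split=> [|E]; first by lia.
  by rewrite equ ?eqvs//; lia.
have {}deg2 : 2 <= size us by [].
split=> [|E]; first by lia.
have us2 : size us <= 2 by lia.
apply/andP; split; last by apply: eq_us; lia.
by apply/orP; right; apply/andP.
Qed.

Lemma size_vertices_binary T : binary T ->
  (size (vertices T)).+1 = (nleaves T).*2.
Proof.
elim/rtree_ind_mem: T => -[|t [|u [|v ts]]] IH // /and3P[_ bt /andP[bu _]].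
rewrite size_vertices_node nleaves_node//=.
have := IH t (mem_head _ _) bt; have := IH u _ bu.
by rewrite in_cons mem_head orbT => /(_ isT); lia.
Qed.

(* By counting vertices: among the trees with k leaves and no unary vertex, the
   binary ones are those with 2k - 1 vertices. *)
Lemma isomorphic_binary T U : nonleaf_degrees (leq 2) T -> binary U ->
  nleaves T = nleaves U -> isomorphic T U -> binary T.
Proof.
move=> dT bU lTU [f [/perm_size + _ _]]; rewrite size_map => vTU.
by apply: (size_vertices_leq dT).2; rewrite vTU lTU size_vertices_binary.
Qed.

(** * Copies as multiplicities of ordered trees *)

Lemma inducedE T (S : {set seq_sub (leaves T)}) :
  Defs.induced S = skeleton T (mem [seq val x | x in S]).
Proof.
rewrite /Defs.induced /skeleton; case: prune => //= U.
by rewrite suppress_reroot.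
Qed.

(** Recording [binary U] and the number of leaves restricts later comparisons to binary ordered
    trees of the size of [D]. *)
Definition is_copy (D : rtree) (o : option rtree) : bool :=
  `[< exists2 U, o = Some U &
      [/\ nleaves U = nleaves D, binary U & isomorphic U D] >].

Lemma copiesE D T : binary D -> copies D T = count (is_copy D) (skeletons T).
Proof.
move=> bD; rewrite /copies card_sublists ?uniq_leaves// skeletonsE count_map.
apply: eq_in_count => s sT /=; rewrite inducedE.
set S := [set x | _].
have SE : [seq val x | x in S] =i s.
  move=> v; apply/fintype.imageP/idP => [[x + ->]|vs]; first by rewrite inE.
  by exists (SeqSub (sublists_sub sT vs)); rewrite ?inE.
have -> : mem [seq val x | x in S] = mem s :> pred _.
  by apply/funext => v; exact: SE.
have -> : #|S| = onleaves (skeleton T (mem s)).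
  rewrite onleaves_skeleton -(size_image val) -size_filter.
  apply/perm_size/uniq_perm => [||v].
  - by rewrite map_inj_uniq ?enum_uniq//; exact: val_inj.
  - by rewrite filter_uniq// uniq_leaves.
  - rewrite SE mem_filter/=; case: (boolP (v \in s)) => //= vs.
    by rewrite (sublists_sub sT vs).
apply/andP/asboolP => [[/eqP lD /asboolP[U UE UD]]|[U UE [lU bU UD]]]; last first.
  by split; [rewrite UE/= lU | apply/asboolP; exists U].
exists U => //; move: lD; rewrite UE/= => lU; split=> //.
(* An induced tree has no unary vertex, so the vertex count forces it to be binary. *)
apply: isomorphic_binary bD lU UD.
move: UE; rewrite /skeleton; case: prune => //= V [<-].
exact: suppress_nonleaf_degrees.
Qed.

(** The count splits over the distinct values satisfying [P]. An isomorphism class is a union of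
    ordered trees, so copies can be compared one ordered tree at a time. *)
Lemma leq_count_mem (A : eqType) (P : pred A) a (s t : seq A) :
  (forall x, P x -> a * count_mem x s <= count_mem x t) ->
  a * count P s <= count P t.
Proof.
move=> le_st.
have sumE (u r : seq A) : uniq u ->
    \sum_(x <- u | P x) count_mem x r = count (fun x => P x && (x \in u)) r.
  elim: u => [|x u IH] /= => [_|/andP[xu uu]].
    rewrite big_nil; apply/esym; under eq_count do rewrite in_nil andbF.
    exact: count_pred0.
  rewrite big_cons IH//.
  case: ifPn => Px.
    rewrite -count_predUI [X in _ + X](_ : _ = 0).
      rewrite addn0; apply: eq_count => y /=; rewrite in_cons.
      by case: eqP => //= ->; rewrite Px.
    rewrite -(count_pred0 r); apply: eq_count => y /=; apply/negbTE.
    by apply/negP => /andP[/eqP-> /andP[_]]; apply/negP.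
  apply: eq_count => y; rewrite in_cons.
  by case: eqP => //= ->; rewrite (negbTE Px).
have us := undup_uniq s.
rewrite (_ : count P s = \sum_(x <- undup s | P x) count_mem x s); last first.
  by rewrite sumE//; apply: eq_in_count => x xs; rewrite mem_undup xs andbT.
rewrite big_distrr/=; apply: (@leq_trans (\sum_(x <- undup s | P x) count_mem x t)).
  exact: leq_sum.
by rewrite sumE//; apply: sub_count => x /andP[].
Qed.

Definition ncopies (U T : rtree) : nat := count_mem (Some U) (skeletons T).

Lemma leq_copies a D T T' : binary D ->
  (forall U, binary U -> nleaves U = nleaves D ->
     a * ncopies U T <= ncopies U T') ->
  a * copies D T <= copies D T'.
Proof.
move=> bD le; rewrite !copiesE//; apply: leq_count_mem => o /asboolP[U -> [lU bU _]].
exact: le.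
Qed.

(** * Recursion for the multiplicities *)

Lemma count_forests_cons us l ls :
  count_mem us (forests (l :: ls)) =
  (if us is u :: us' then count_mem (Some u) l * count_mem us' (forests ls)
   else 0)
  + count_mem None l * count_mem us (forests ls).
Proof.
rewrite /=; set F := forests ls.
elim: l => [|o l IH]; first by case: us.
rewrite allpairs_cons count_cat IH count_map /=.
rewrite [X in X + _](_ : _ = (if us is u :: us' then (o == Some u) * count_mem us' F
   else 0) + (o == None) * count_mem us F); last first.
  case: o => [v|]; last first.
    by rewrite [RHS](_ : _ = count_mem us F); [apply: eq_count|case: (us) => /=; lia].
  rewrite addn0; case: us {IH} => [|u us].
    by rewrite -(count_pred0 F); apply: eq_count.
  rewrite (_ : (Some v == Some u) = (v == u))//.
  case: (v =P u) => [->|vu]; rewrite ?mul1n ?mul0n.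
    by apply: eq_count => w /=; rewrite eqseq_cons eqxx.
  rewrite -(count_pred0 F); apply: eq_count => w /=.
  by rewrite eqseq_cons; case: eqP.
by case: us {IH} => [|u us] /=; nia.
Qed.

(** Only the empty leaf set induces nothing. This 1 is the weight of each branch that a copy
    avoids. *)
Lemma count_None_skeletons T : count_mem None (skeletons T) = 1.
Proof.
elim/rtree_ind_mem: T => -[|t ts] IH //.
rewrite skeletons_node// count_map.
rewrite (@eq_count _ _ (pred1 [::])); last by case=> [|u [|v us]].
elim: (t :: ts) IH => // u us IHus IH.
rewrite map_cons count_forests_cons add0n IH ?mem_head// mul1n IHus//.
by move=> x xus; apply: IH; rewrite in_cons xus orbT.
Qed.

(** The sum of f(t_i) g(t_j) over i < j; the order matters because induced trees keep the
    left-to-right order of branches. *)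
Fixpoint pair_sum (f g : rtree -> nat) (ts : seq rtree) : nat :=
  if ts is t :: ts' then f t * sumn (map g ts') + pair_sum f g ts' else 0.

Lemma count_forests1 u ts :
  count_mem [:: u] (forests (map skeletons ts)) = sumn (map (ncopies u) ts).
Proof.
elim: ts => // t ts IH; rewrite map_cons count_forests_cons IH.
rewrite count_None_skeletons mul1n/=; congr (_ + _).
suff -> : count_mem [::] (forests (map skeletons ts)) = 1 by rewrite muln1.
elim: (ts) => // v vs IHvs.
by rewrite map_cons count_forests_cons IHvs count_None_skeletons.
Qed.

Lemma count_forests2 u v ts :
  count_mem [:: u; v] (forests (map skeletons ts)) =
  pair_sum (ncopies u) (ncopies v) ts.
Proof.
elim: ts => // t ts IH.
by rewrite map_cons count_forests_cons IH count_forests1 count_None_skeletons mul1n.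
Qed.

Lemma eq_Node ts us : (Node ts == Node us) = (ts == us).
Proof. by apply/eqP/eqP => [[]|->]. Qed.

Lemma ncopies_in_leaf U : ncopies U (Node [::]) = (U == Node [::]).
Proof. by rewrite /ncopies/= (eq_sym U) [X in _ + X](_ : _ = 0) ?addn0. Qed.

Lemma ncopies_leaf T : ncopies (Node [::]) T = nleaves T.
Proof.
elim/rtree_ind_mem: T => -[|t ts] IH; first by rewrite ncopies_in_leaf eqxx.
rewrite nleaves_node// /ncopies skeletons_node// count_map.
rewrite (@eq_count _ _ (pred1 [:: Node [::]])).
  rewrite count_forests1; congr sumn; apply/eq_in_map => x xts; exact: IH.
case=> [|u [|v us]] //=; first by rewrite eqseq_cons andbT.
by rewrite eqseq_cons andbF [LHS]eq_Node.
Qed.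

(** The most recent common ancestor of a copy lies in one branch, or is the root; then exactly two
    branches are met, the left one in [u] and the right one in [v]. *)
Lemma ncopies_node u v ts : ts != [::] ->
  ncopies (Node [:: u; v]) (Node ts) =
  sumn (map (ncopies (Node [:: u; v])) ts) + pair_sum (ncopies u) (ncopies v) ts.
Proof.
move=> ts0; rewrite /ncopies skeletons_node// count_map.
rewrite -count_forests1 -count_forests2 -count_predUI.
rewrite [X in _ + X](_ : _ = 0) ?addn0.
  apply: eq_count => -[|x [|y us]] //=.
    by rewrite [LHS](_ : _ = (x == Node [:: u; v]))// !eqseq_cons andbT andbF orbF.
  by rewrite [LHS]eq_Node !eqseq_cons andbF.
rewrite -(count_pred0 (forests (map skeletons ts))); apply: eq_count => us /=.
by apply/negbTE/negP => /andP[/eqP-> /eqP].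
Qed.

(** * Tools for comparing multiplicities *)

Lemma binary_node2 u v : binary u -> binary v -> binary (Node [:: u; v]).
Proof. by rewrite /binary /dary /= => -> ->. Qed.

Lemma binary_ind (P : rtree -> Prop) : P (Node [::]) ->
  (forall u v, binary u -> binary v -> P u -> P v -> P (Node [:: u; v])) ->
  forall T, binary T -> P T.
Proof.
move=> P0 P2; elim/rtree_ind_mem => -[|u [|v [|w ts]]] IH // /and3P[_ bu /andP[bv _]].
by apply: P2 => //; apply: IH; rewrite // !in_cons eqxx ?orbT.
Qed.

Lemma leq_sumn_map a (f g : rtree -> nat) ts :
  {in ts, forall t, a * f t <= g t} -> a * sumn (map f ts) <= sumn (map g ts).
Proof.
elim: ts => [|t ts IH] le /=; first by rewrite muln0.
rewrite mulnDr leq_add ?le ?mem_head ?IH// => x xts.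
by apply: le; rewrite in_cons xts orbT.
Qed.

Lemma leq_pair_sum a b (f g f' g' : rtree -> nat) ts :
  {in ts, forall t, a * f t <= f' t} -> {in ts, forall t, b * g t <= g' t} ->
  a * b * pair_sum f g ts <= pair_sum f' g' ts.
Proof.
elim: ts => [|t ts IH] lef leg /=; first by rewrite muln0.
have sub x : x \in ts -> x \in t :: ts by rewrite in_cons => ->; rewrite orbT.
rewrite mulnDr leq_add//; last first.
  by apply: IH => x /sub; [exact: lef | exact: leg].
rewrite mulnACA leq_mul ?lef ?mem_head// leq_sumn_map// => x /sub.
exact: leg.
Qed.

Lemma pair_sum_map f g h ts : pair_sum f g (map h ts) = pair_sum (f \o h) (g \o h) ts.
Proof. by elim: ts => //= t ts ->; rewrite -map_comp. Qed.

Lemma pair_sum_cat f g ts us :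
  pair_sum f g ts <= pair_sum f g (ts ++ us).
Proof.
elim: ts => //= t ts IH; rewrite map_cat sumn_cat mulnDr.
by rewrite -addnA leq_add2l (leq_trans IH)// leq_addl.
Qed.

(** * Binarization *)

Fixpoint caterpillar (ts : seq rtree) : rtree :=
  match ts with
  | [::] => Node [::]
  | [:: t] => t
  | t :: ts' => Node [:: t; caterpillar ts']
  end.

Fixpoint binarize (T : rtree) : rtree :=
  let: Node ts := T in caterpillar (map binarize ts).

Lemma binarize_node ts : binarize (Node ts) = caterpillar (map binarize ts).
Proof. by []. Qed.

Lemma nleaves_caterpillar ts : ts != [::] ->
  nleaves (caterpillar ts) = sumn (map nleaves ts).
Proof.
elim: ts => // t [|u ts] IH _; first by rewrite /= addn0.
by rewrite [caterpillar _]/= nleaves_node//= -/(caterpillar (u :: ts)) IH//= addn0.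
Qed.

Lemma nleaves_binarize T : nleaves (binarize T) = nleaves T.
Proof.
elim/rtree_ind_mem: T => -[|t ts] IH //.
rewrite nleaves_node// binarize_node nleaves_caterpillar// -map_comp.
by congr sumn; apply/eq_in_map.
Qed.

Lemma binary_binarize T : binary (binarize T).
Proof.
elim/rtree_ind_mem: T => ts IH; rewrite binarize_node.
elim: ts IH => // t [|u ts] IHts IH; first by apply: IH; rewrite mem_head.
have -> : caterpillar (map binarize [:: t, u & ts]) =
  Node [:: binarize t; caterpillar (map binarize (u :: ts))] by [].
apply: binary_node2; first by apply: IH; rewrite mem_head.
by apply: IHts => x xus; apply: IH; rewrite in_cons xus orbT.
Qed.

Lemma sumn_ncopies_leq U ts : ts != [::] -> binary U ->
  sumn (map (ncopies U) ts) <= ncopies U (Node ts).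
Proof.
move=> ts0; elim/binary_ind => [|u v _ _ _ _].
  rewrite ncopies_leaf nleaves_node//; apply/eq_leq; congr sumn.
  by apply/eq_map => x; exact: ncopies_leaf.
by rewrite ncopies_node// leq_addr.
Qed.

(** A pair of branches i < j now meets at the spine vertex of i. Copies of [v] spread over several
    later branches can only add to the count. *)
Lemma ncopies_caterpillar ts U : ts != [::] -> binary U ->
  ncopies U (Node ts) <= ncopies U (caterpillar ts).
Proof.
move=> + bU; elim: ts U bU => // t [|s ts] IH U bU _.
  elim/binary_ind: U / bU => [|u v _ _ _ _].
    by rewrite !ncopies_leaf nleaves_node//= addn0.
  by rewrite ncopies_node//=; lia.
have -> : caterpillar [:: t, s & ts] = Node [:: t; caterpillar (s :: ts)] by [].
elim/binary_ind: U / bU => [|u v bu bv _ _].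
  rewrite !ncopies_leaf !nleaves_node// !map_cons [sumn (_ :: _)]/=.
  by rewrite nleaves_caterpillar//= addn0.
have := IH _ (binary_node2 bu bv) isT.
have /leq_trans/(_ (IH _ bv isT)) := sumn_ncopies_leq (isT : s :: ts != [::]) bv.
move: (s :: ts) (isT : s :: ts != [::]) => us us0 lev.
rewrite !ncopies_node//= !addn0.
have := leq_mul (leqnn (ncopies u t)) lev; lia.
Qed.

Lemma ncopies_binarize T U : binary U -> ncopies U T <= ncopies U (binarize T).
Proof.
move=> bU; elim/rtree_ind_mem: T U bU => -[|t ts] IH U bU //.
rewrite binarize_node.
apply: leq_trans (ncopies_caterpillar _ bU) => //.
elim/binary_ind: bU => [|u v bu bv _ _].
  rewrite !ncopies_leaf !nleaves_node// -map_comp.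
  by apply/eq_leq; congr sumn; apply/eq_map => x /=; rewrite nleaves_binarize.
rewrite !ncopies_node// pair_sum_map -map_comp.
apply: leq_add.
  rewrite -[leqLHS]mul1n; apply: leq_sumn_map => x /IH le; rewrite mul1n; apply: le.
  exact: binary_node2.
rewrite -[leqLHS]mul1n -(mul1n 1%N).
by apply: leq_pair_sum => x /IH le; rewrite mul1n; exact: le.
Qed.

(** * Grafting, padding and complete trees *)

Fixpoint graft (d : nat) (K T : rtree) : rtree :=
  let: Node ts := T in
  if ts is [::] then K
  else Node (map (graft d K) ts ++ nseq (d - size ts) (Node [::])).

Lemma graft_node d K ts : ts != [::] ->
  graft d K (Node ts) = Node (map (graft d K) ts ++ nseq (d - size ts) (Node [::])).
Proof. by case: ts. Qed.

Lemma strictly_dary_graft d K T : strictly_dary d K -> dary d T ->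
  strictly_dary d (graft d K T).
Proof.
move=> dK; elim/rtree_ind_mem: T => -[|t ts] IH // /andP[/orP[//|/andP[_ led]] dts].
rewrite graft_node//; apply/andP; split.
  by apply/orP; right; rewrite size_cat size_map size_nseq subnKC.
rewrite all_cat; apply/andP; split; last by apply/allP => x /nseqP[->].
by rewrite all_map; apply/allP => x xts /=; apply: IH => //; exact: (allP dts).
Qed.

Lemma nleaves_graft_ge d K T : nleaves K * nleaves T <= nleaves (graft d K T).
Proof.
elim/rtree_ind_mem: T => -[|t ts] IH; first by rewrite muln1.
rewrite graft_node// !nleaves_node// map_cat sumn_cat.
apply: leq_trans (leq_addr _ _).
by rewrite -map_comp; exact: leq_sumn_map.
Qed.

(** The extra [d] on the left pays for the padding: m >= 2 branches free m d, and d - m padding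
    leaves plus the new extra d fit into that. *)
Lemma nleaves_graft_le d K T : dary d T ->
  nleaves (graft d K T) + d <= (nleaves K + d) * nleaves T.
Proof.
elim/rtree_ind_mem: T => -[|t ts] IH; first by rewrite muln1.
move=> /andP[/orP[//|/andP[ge2 led]] dts].
rewrite graft_node// !nleaves_node// map_cat sumn_cat map_nseq sumn_nseq.
have le us :
    {in us, forall t, nleaves (graft d K t) + d <= (nleaves K + d) * nleaves t} ->
    sumn (map nleaves (map (graft d K) us)) + size us * d <=
    (nleaves K + d) * sumn (map nleaves us).
  elim: us => //= u us IHus h.
  have hus x : x \in us -> nleaves (graft d K x) + d <= (nleaves K + d) * nleaves x.
    by move=> xus; apply: h; rewrite in_cons xus orbT.
  by have := IHus hus; have := h u (mem_head _ _); lia.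
have {le} := le (t :: ts) (fun x xts => IH x xts (allP dts x xts)).
rewrite (_ : nleaves (Node [::]) = 1)//.
set k := size (t :: ts) in ge2 led *; nia.
Qed.

(** Each leaf of a copy in [T] may be replaced by any leaf of the tree grafted on it,
    independently. *)
Lemma ncopies_graft d K T U : binary U ->
  nleaves K ^ nleaves U * ncopies U T <= ncopies U (graft d K T).
Proof.
move=> bU; elim/rtree_ind_mem: T U bU => -[|t ts] IH U bU.
  elim/binary_ind: bU => [|u v bu bv _ _]; first by rewrite !ncopies_leaf muln1 expn1.
  by rewrite ncopies_in_leaf eq_Node muln0.
elim/binary_ind: U / bU => [|u v bu bv _ _].
  by rewrite !ncopies_leaf expn1 nleaves_graft_ge.
have buv := binary_node2 bu bv.
rewrite graft_node// !ncopies_node// mulnDr map_cat sumn_cat.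
apply: leq_add.
  apply: leq_trans (leq_addr _ _).
  by rewrite -map_comp; apply: leq_sumn_map => x /IH le; exact: le.
apply: leq_trans (pair_sum_cat _ _ _ _); rewrite pair_sum_map.
have -> : nleaves (Node [:: u; v]) = nleaves u + nleaves v.
  by rewrite nleaves_node//= addn0.
rewrite expnD.
by apply: leq_pair_sum => x /IH le; exact: le.
Qed.

Fixpoint complete (d h : nat) : rtree :=
  if h is h'.+1 then Node (nseq d (complete d h')) else Node [::].

Lemma nleaves_complete d h : 0 < d -> nleaves (complete d h) = d ^ h.
Proof.
move=> d0; elim: h => //= h IH; rewrite nleaves_node; last by case: d d0 {IH}.
by rewrite map_nseq sumn_nseq IH expnSr.
Qed.

Lemma strictly_dary_complete d h : strictly_dary d (complete d h).
Proof.
elim: h => //= h IH; rewrite /strictly_dary/= size_nseq eqxx orbT/=.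
by apply/allP => x /nseqP[->].
Qed.

(** A non-leaf vertex adds up d residues 1, and d is 1 modulo d - 1. *)
Lemma strictly_dary_mod d T : 0 < d -> strictly_dary d T ->
  nleaves T = 1 %[mod d.-1].
Proof.
move=> d0; elim/rtree_ind_mem: T => -[|t ts] IH // /andP[/orP[//|/eqP szd] dts].
rewrite nleaves_node//.
have le us : {in us, forall t, nleaves t = 1 %[mod d.-1]} ->
    sumn (map nleaves us) = size us %[mod d.-1].
  elim: us => //= u us IHus h.
  rewrite -modnDm h ?mem_head// IHus ?modnDm ?add1n// => x xus.
  by apply: h; rewrite in_cons xus orbT.
rewrite (le (t :: ts)) => [|x xts]; last by apply: IH => //; exact: (allP dts).
by rewrite szd -{1}(prednK d0) -add1n modnDr.
Qed.

(** * Density under grafting *)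

Lemma ffact_le_exp n m : n ^_ m <= n ^ m.
Proof.
rewrite ffact_prod -[in leqRHS](card_ord m) -prod_nat_const.
by apply: leq_prod => i _; exact: leq_subr.
Qed.

Lemma exp_le_ffact n m : (n - m) ^ m <= n ^_ m.
Proof.
rewrite ffact_prod -[in X in _ ^ X](card_ord m) -prod_nat_const.
by apply: leq_prod => i _; apply: leq_sub2l; exact: ltnW.
Qed.

Section Inducibility.
Local Open Scope classical_set_scope.
Local Open Scope ring_scope.
Variable R : realType.
Implicit Types (B T : rtree).

Lemma density_ge0 B T : 0 <= density R B T.
Proof. by rewrite divr_ge0. Qed.

Lemma exprD1_le (x : R) m : 0 <= x <= 1 -> (1 + x) ^+ m <= 1 + (2 ^ m)%:R * x.
Proof.
(* The induction is run on the sharper chord of the convex function (1 + x)^m over [0, 1]. *)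
move=> /andP[x0 x1]; apply: (@le_trans _ _ (1 + ((2 ^ m)%:R - 1) * x)); last first.
  by rewrite lerD2l ler_wpM2r// gerBl.
elim: m => [|m IH]; first by rewrite expr0 expn0 subrr mul0r addr0.
rewrite exprSr expnS natrM.
have : 1 <= (2 ^ m)%:R :> R by rewrite ler1n expn_gt0.
move: (2 ^ m)%:R IH => a IH a1.
apply: (@le_trans _ _ ((1 + (a - 1) * x) * (1 + x))).
  by rewrite ler_wpM2r// addr_ge0.
by have : 0 <= (a - 1) * x * (1 - x); [rewrite !mulr_ge0// subr_ge0 | lra].
Qed.

Lemma exprD1_close (d : R) m : 0 < d ->
  exists2 x : R, 0 < x & (1 + x) ^+ m <= 1 + d.
Proof.
move=> d0; have a0 : 0 < (2 ^ m)%:R :> R by rewrite ltr0n expn_gt0.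
exists (Num.min 1 (d / (2 ^ m)%:R)); first by rewrite lt_min ltr01 divr_gt0.
apply: (le_trans (exprD1_le _ _)).
  by rewrite ge_min lexx/= andbT le_min ler01 divr_ge0// ltW.
by rewrite lerD2l mulrC -ler_pdivlMr// ge_min lexx orbT.
Qed.

(** With k = |B|, n = |T| and M = |K|, copies grow at least by M^k, while the binomial ratio is at
    most ((M + d) n)^k / (n - k)^k. The quotient of these bounds is the stated factor. *)
Lemma density_graft d K T B : binary B -> dary d T ->
  (nleaves B < nleaves T)%N ->
  density R B T <= density R B (graft d K T) *
    ((1 + d%:R / (nleaves K)%:R) *
     (1 + (nleaves B)%:R / (nleaves T - nleaves B)%:R)) ^+ nleaves B.
Proof.
move=> bB dT ltBT.
set n := nleaves T in ltBT *; set k := nleaves B in ltBT *; set M := nleaves K.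
have M0 : (0 < M)%N := nleaves_gt0 K.
have nk0 : (0 < n - k)%N by rewrite subn_gt0.
set N := nleaves (graft d K T).
have NM : (N <= (M + d) * n)%N.
  by apply: leq_trans (nleaves_graft_le K dT); exact: leq_addr.
have MN : (M * n <= N)%N := nleaves_graft_ge d K T.
have kN : (k <= N)%N by apply: leq_trans MN; nia.
have cop : (M ^ k * copies B T <= copies B (graft d K T))%N.
  by apply: leq_copies => // U bU lU; rewrite /k -lU; exact: ncopies_graft.
have key : (copies B T * 'C(N, k) * (M * (n - k)) ^ k <=
            copies B (graft d K T) * 'C(n, k) * ((M + d) * n) ^ k)%N.
  (* Multiplying by k! turns the binomials into falling factorials, which lie between powers. *)
  rewrite -(leq_pmul2r (fact_gt0 k)).
  have -> : (copies B T * 'C(N, k) * (M * (n - k)) ^ k * k`! =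
    (M ^ k * copies B T) * ('C(N, k) * k`!) * (n - k) ^ k)%N.
    by rewrite expnMn; lia.
  have -> : (copies B (graft d K T) * 'C(n, k) * ((M + d) * n) ^ k * k`! =
     copies B (graft d K T) * ((M + d) * n) ^ k * ('C(n, k) * k`!))%N by lia.
  rewrite !bin_ffact; apply: leq_mul; last exact: exp_le_ffact.
  apply: leq_mul => //; apply: (leq_trans (ffact_le_exp _ _)).
  by rewrite leq_exp2r// nleaves_gt0.
have Mr : M%:R != 0 :> R by rewrite pnatr_eq0 -lt0n.
have nkr : (n - k)%:R != 0 :> R by rewrite pnatr_eq0 -lt0n.
have -> : (1 + d%:R / M%:R) * (1 + k%:R / (n - k)%:R) =
    ((M + d) * n)%:R / (M * (n - k))%:R :> R.
  have {2}-> : n = (n - k + k)%N by rewrite subnK// ltnW.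
  by rewrite !natrM !natrD; field; rewrite Mr nkr.
rewrite expr_div_n -!natrX /density -/n -/k -/N.
have C0 a : (k <= a)%N -> 0 < 'C(a, k)%:R :> R by rewrite ltr0n bin_gt0.
rewrite mulf_div ler_pdivrMr ?C0 1?ltnW// mulrAC ler_pdivlMr; last first.
  by rewrite mulr_gt0 ?C0// ltr0n expn_gt0 muln_gt0 M0 nk0.
rewrite -!natrM ler_nat; move: key; lia.
Qed.

(** * From binary to strictly d-ary trees *)

Lemma dary_leq d d' T : (d <= d')%N -> dary d T -> dary d' T.
Proof.
move=> dd'; elim/rtree_ind_mem: T => ts IH /andP[P /allP dts].
apply/andP; split; last by apply/allP => t tts; exact: IH (dts _ tts).
by case/orP: P => [->//|/andP[-> led]]; rewrite (leq_trans led) ?orbT.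
Qed.

(** Grafting complete trees of large height gives strictly d-ary trees whose leaf counts are large
    and 1 modulo d - 1, hence in [A]; the correction factor costs at most [e] once n is large. *)
Lemma max_density_le_sup d B (A : set nat) (e : R) : binary B -> (2 <= d)%N ->
  0 < e -> within [set n | n = 1 %[mod d.-1]]%N \oo A ->
  \forall n \near \oo, (max_density R (dary 2) B n <=
    ereal_sup (max_density R (strictly_dary d) B @` A) + e%:E)%E.
Proof.
move=> bB d2 e0 [n0 _ An0]; set s := ereal_sup _.
have d0 : (0 < d)%N by exact: ltnW.
suff : exists m, forall n T, (m <= n)%N -> nleaves T = n -> dary 2 T ->
    ((density R B T)%:E <= s + e%:E)%E.
  move=> [m sup_le]; exists m => // n /= mn.
  by apply/ereal_supP => _ [T [Tn dT] <-]; exact: sup_le Tn dT.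
have sup_ge T : dary d T -> forall h, (n0 <= d ^ h)%N ->
    ((density R B (graft d (complete d h) T))%:E <= s)%E.
  move=> dT h n0h; set T' := graft _ _ _.
  have dT' : strictly_dary d T'.
    by apply: strictly_dary_graft => //; exact: strictly_dary_complete.
  apply: (@le_trans _ _ (max_density R (strictly_dary d) B (nleaves T'))).
    by apply: ereal_sup_ubound; exists T'.
  apply: ereal_sup_ubound; exists (nleaves T') => //; apply: An0 => /=; last first.
    exact: strictly_dary_mod.
  apply: (leq_trans n0h); rewrite -(nleaves_complete h d0).
  by apply: leq_trans (nleaves_graft_ge _ _ _); rewrite leq_pmulr// nleaves_gt0.
(* An infinite supremum is trivial, and -oo is excluded by the density of any graft. *)
case: s sup_ge => [r||] sup_ge; last 2 first.
- by exists 0%N => n T _ _ _; rewrite addye// leey.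
- exists 0%N => n T _ _ dT.
  by have := sup_ge T (dary_leq d2 dT) n0 (ltnW (ltn_expl n0 d2)).
(* Both factors of the correction will be at most 1 + x, hence the exponent 2 |B|. As grafted
   densities are at most r, a relative error e / (|r| + 1) costs at most e. *)
have [x x0 xe] := @exprD1_close (e / (`|r| + 1)) (2 * nleaves B)
  (divr_gt0 e0 (ltr_wpDl (normr_ge0 r) ltr01)).
pose k := nleaves B.
exists (k + (Num.truncn (k%:R / x)).+1)%N => n T mn Tn dT2.
have dT := dary_leq d2 dT2.
(* Since h < d^h, this height gives both d^h >= n0 and d / d^h <= x. *)
pose h := maxn n0 (Num.truncn (d%:R / x)).+1.
have hd : (h < d ^ h)%N by exact: ltn_expl.
have n0h : (n0 <= d ^ h)%N by rewrite (leq_trans (leq_maxl _ _) (ltnW hd)).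
have {}sup_ge := sup_ge T dT h n0h; rewrite lee_fin in sup_ge.
rewrite -EFinD lee_fin.
have nk : (k < nleaves T)%N by rewrite Tn (leq_trans _ mn)// -addSnnS leq_addr.
apply: (le_trans (density_graft (complete d h) bB dT nk)).
set g := density _ _ _ in sup_ge *.
have g0 : 0 <= g := density_ge0 _ _.
have ratio_le (a b : nat) : (Num.truncn (a%:R / x) < b)%N -> 1 + a%:R / b%:R <= 1 + x.
  move=> ab; have b0 : (0 < b)%N by exact: leq_ltn_trans ab.
  rewrite lerD2l ler_pdivrMr ?ltr0n// mulrC -ler_pdivrMr//.
  by apply: (le_trans (ltW (truncnS_gt _))); rewrite ler_nat.
apply: (@le_trans _ _ (g * (1 + e / (`|r| + 1)))).
  rewrite ler_wpM2l//; apply: le_trans xe; rewrite exprM.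
  have ge0 (a b : nat) : 0 <= 1 + a%:R / b%:R :> R by rewrite addr_ge0// divr_ge0.
  apply: lerXn2r; rewrite ?nnegrE ?sqr_ge0//.
  rewrite expr2; apply: ler_pM => //.
    apply: ratio_le; rewrite nleaves_complete//.
    by rewrite (leq_ltn_trans _ hd)// (leq_trans _ (leq_maxr _ _)).
  apply: ratio_le; rewrite Tn -/k.
  by rewrite ltn_subRL (leq_trans _ mn)// addnS.
rewrite mulrDr mulr1 lerD// mulrA ler_pdivrMr ?ltr_wpDl//.
rewrite mulrC ler_wpM2l// ?(ltW e0)//.
by rewrite (le_trans sup_ge)// (le_trans (ler_norm r))// lerDl.
Qed.

(** * Comparing limits superior *)

Lemma le_limf_esup (F : set_system nat) (f g : nat -> \bar R) :
  (forall n, (f n <= g n)%E) -> (limf_esup f F <= limf_esup g F)%E.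
Proof.
move=> fg; rewrite !limf_esupE; apply/ereal_infP => _ [A FA <-].
apply: ge_ereal_inf; exists (ereal_sup (f @` A)); first by exists A.
apply/ereal_supP => _ [n An <-]; apply: (le_trans (fg n)).
by apply: ereal_sup_ubound; exists n.
Qed.

(** The restricted filter has more sets, so the infimum of suprema can only drop. *)
Lemma limf_esup_within_le (D : set nat) (F : set_system nat) {FF : Filter F}
    (f : nat -> \bar R) :
  (limf_esup f (within D F) <= limf_esup f F)%E.
Proof.
rewrite !limf_esupE; apply/ereal_infP => _ [A FA <-].
apply: ge_ereal_inf; exists (ereal_sup (f @` A)) => //.
by exists A => //; apply: filterS FA => x Ax _.
Qed.

Lemma max_density_mono (P Q : pred rtree) B n :
  (forall T, P T -> Q T) -> (max_density R P B n <= max_density R Q B n)%E.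
Proof.
move=> PQ; apply: ereal_sup_le => _ [T [Tn PT] <-].
by exists T => //; split=> //; exact: PQ.
Qed.

Lemma strictly_dary_dary d T : (2 <= d)%N -> strictly_dary d T -> dary d T.
Proof.
move=> d2; elim/rtree_ind_mem: T => ts IH /andP[P /allP dts].
apply/andP; split; last by apply/allP => t tts; exact: IH (dts _ tts).
by case/orP: P => [->//|/eqP->]; rewrite d2 leqnn orbT.
Qed.

Lemma dary2E : dary 2 = strictly_dary 2.
Proof.
apply/funext => T; rewrite /dary /strictly_dary.
elim/rtree_ind_mem: T => ts IH /=; congr (_ && _); last exact: eq_in_all.
by rewrite eqn_leq andbC.
Qed.

(** Binarization keeps the number of leaves and loses no copy, so equality holds for every n and not
    just in the limit. *)
Lemma max_density_dary d B n : binary B -> (2 <= d)%N ->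
  max_density R (dary d) B n = max_density R (dary 2) B n.
Proof.
move=> bB d2; apply/eqP; rewrite eq_le; apply/andP; split; last first.
  by apply: max_density_mono => T; exact: dary_leq.
apply/ereal_supP => _ [T [Tn dT] <-].
apply: (@le_trans _ _ (density R B (binarize T))%:E); last first.
  apply: ereal_sup_ubound; exists (binarize T) => //; split.
    by rewrite nleaves_binarize.
  exact: binary_binarize.
rewrite lee_fin /density nleaves_binarize ler_wpM2r ?invr_ge0// ler_nat.
rewrite -[leqLHS]mul1n; apply: leq_copies => // U bU _; rewrite mul1n.
exact: ncopies_binarize.
Qed.

End Inducibility.

Theorem theorem7 (R : realType) (B : rtree) (hB : binary B)
    (hB2 : (2 <= nleaves B)%N) (d : nat) (hd : (2 <= d)%N) :
  strict_inducibility R d B = strict_inducibility R 2 B /\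
  strict_inducibility R 2 B = inducibility R d B /\
  inducibility R d B = inducibility R 2 B.
Proof.
have Id : inducibility R d B = inducibility R 2 B.
  by congr limf_esup; apply/funext => n; exact: max_density_dary.
have i2 : strict_inducibility R 2 B = inducibility R 2 B.
  rewrite /strict_inducibility -dary2E; congr limf_esup.
  apply/funext => A; apply/propext; split => [|FA]; last by apply: filterS FA => x Ax _.
  (* For d = 2 the modulus is 1, so the congruence restricts nothing. *)
  by move=> [n0 _ An0]; exists n0 => // n /An0; apply; rewrite /= !modn1.
split; last by rewrite i2 Id.
apply/eqP; rewrite eq_le i2; apply/andP; split.
  rewrite -Id; apply: (le_trans (limf_esup_within_le _ _)).
  by apply: le_limf_esup => n; apply: max_density_mono => T; exact: strictly_dary_dary.
(* The strict limit superior is an infimum over sets [A] of the filter; each supremum over [A]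
   bounds the binary one up to any e > 0. *)
rewrite /strict_inducibility limf_esupE; apply/ereal_infP => _ [A FA <-].
apply/lee_addgt0Pr => e e0.
have [n0 _ near_le] := max_density_le_sup hB hd e0 FA.
apply: ge_ereal_inf; eexists; first by exists [set n | n0 <= n]%classic; [exists n0|].
by apply/ereal_supP => _ [n le <-]; exact: near_le.
Qed.
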